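(* Let $(\mathfrak h,(H_i,L_i)_{i\in I})$ be a linear Coxeter system with linear Coxeter group $\mathcal W$, closed fundamental chamber $\overline C$ and Tits cone $X$. Let $Y\subseteq X$ be a $\mathcal W$-invariant convex subcone containing $0$. Let $R_1,R_2\in\Upsilon$ and $\tau\in{}^{\upsilon(R_1)}\mathcal W^{\upsilon(R_2)}$. Then we have: (a) $R_1\cap\tau R_2$ is the biggest element of $$\{R\in\Upsilon\mid R\subseteq R_1,\ R\subseteq R_2,\ \mathrm{red}(\tau)\subseteq\upsilon_*(R)\}.$$ In particular, $R_1\cap\tau R_2\in\Upsilon$ with $\upsilon_*(R_1)\cup\upsilon_*(R_2)\cup\mathrm{red}(\tau)\subseteq\upsilon_*(R_1\cap\tau R_2)$. (b) $R_1\vee\tau R_2$ is the smallest element of $$\{R\in\Upsilon\mid R_1\subseteq R,\ R_2\subseteq R,\ \mathrm{red}(\tau)\subseteq\upsilon^*(R)\}.$$ In particular, $R_1\vee\tau R_2\in\Upsilon$ with $\upsilon^*(R_1)\cup\upsilon^*(R_2)\cup\mathrm{red}(\tau)\subseteq\upsilon^*(R_1\vee\tau R_2)$.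
   Context: $\mathbb R^+=(0,\infty)$. A convex cone is a subset of a real vector space closed under addition and under multiplication by elements of $\mathbb R^+$. $\mathrm{ri}$ denotes the relative interior of a finite-dimensional convex set. For a convex cone $K$ containing $0$, a face of $K$ is a convex cone $F\subseteq K$ with $(K\setminus F)+K\subseteq K\setminus F$; $\mathrm{Fa}(K)$ is the set of nonempty faces, ordered by inclusion. It is a complete lattice with meet given by intersection; $\vee$ denotes the join in $\mathrm{Fa}(Y)$. Linear Coxeter systems. Let $\mathfrak h$ be a finite-dimensional real vector space, $n\ge1$, $I=\{1,\dots,n\}$. For a zero-based closed ray $H\subseteq\mathfrak h$ put $H^{\ge0}=\{\lambda\in\mathfrak h^*\mid\lambda(h)\ge0\ \forall h\in H\}$, $H^{>0}=\{\lambda\mid\lambda(h)>0\ \forall h\in H\setminus\{0\}\}$, $H^{=0}=\{\lambda\mid\lambda(h)=0\ \forall h\in H\}$. A linear Coxeter system $(\mathfrak h,(H_i,L_i)_{i\in I})$ consists of zero-based closed rays $H_i\subseteq\mathfrak h$, $L_i\subseteq\mathfrak h^*$ with $L_i\setminus\{0\}\subseteq H_i^{>0}$ such that: (1) the closed fundamental chamber $\overline C=\bigcap_{i\in I}H_i^{\ge0}$ spans $\mathfrak h^*$, and $\overline C\cap H_i^{=0}$, $i\in I$, are its pairwise different faces of codimension 1; (2) with $C=\bigcap_{i\in I}H_i^{>0}$ and $\mathcal W$ (the linear Coxeter group) the group generated by the reflections $\sigma_i$ on $\mathfrak h^*$ at the hyperplane $H_i^{=0}$ along the line $L_i\cup(-L_i)$,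 one has $\sigma C\cap C=\emptyset$ for all $\sigma\in\mathcal W\setminus\{1\}$. Then $(\mathcal W,(\sigma_i)_{i\in I})$ is a Coxeter system; $\mathcal W_J$ is the subgroup generated by $\sigma_j$, $j\in J$. The Tits cone is the convex cone $X=\bigcup_{\sigma\in\mathcal W}\sigma\overline C$. For $J,K\subseteq I$, ${}^J\mathcal W^K$ denotes the set of minimal length double coset representatives of $\mathcal W_J\backslash\mathcal W/\mathcal W_K$. For $\sigma\in\mathcal W$ with reduced expression $\sigma=\sigma_{i_1}\cdots\sigma_{i_k}$, $\mathrm{red}(\sigma)=\{i_1,\dots,i_k\}$ (independent of the reduced expression), and $\mathrm{red}(1)=\emptyset$. $\Upsilon=\{R\in\mathrm{Fa}(Y)\mid\mathrm{ri}(R)\cap\overline C\ne\emptyset\}$. For $R\in\Upsilon$: $\upsilon(R)=\{i\in I\mid\sigma_iR=R\}$, $\upsilon_*(R)=\{i\in I\mid\sigma_i\text{ fixes }R\text{ pointwise}\}$, $\upsilon^*(R)=\upsilon(R)\setminus\upsilon_*(R)$. *)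

(* Defs.v *)
From HB Require Import structures.
From mathcomp Require Import all_boot all_order all_algebra.
From mathcomp Require Import all_classical all_reals all_analysis.

Set Implicit Arguments.
Unset Strict Implicit.
Unset Printing Implicit Defensive.

Import Order.TTheory GRing.Theory Num.Theory.
Import VectorInternalTheory.
Import numFieldNormedType.Exports.

Local Open Scope classical_set_scope.
Local Open Scope ring_scope.

Section Convex.
Context {R : realType} {V : vectType R}.
Implicit Types (A K F G U : set V).

Definition convex_cone K : Prop :=
  (forall x y, K x -> K y -> K (x + y)) /\
  (forall (t : R) x, 0 < t -> K x -> K (t *: x)).

Definition is_face K F : Prop :=
  [/\ convex_cone F, F `<=` K &
      forall x y, (K `\` F) x -> K y -> (K `\` F) (x + y)].

Definition Fa K : set (set V) := [set F | is_face K F /\ F !=set0].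

(* Fa K is a complete lattice whose meet is the intersection, so the join is
   the intersection of all common upper bounds; see face_joinP. *)
Definition face_join K F G : set V :=
  [set x | forall E, Fa K E -> F `<=` E -> G `<=` E -> E x].

Definition affine_hull A : set V :=
  [set x | exists (m : nat) (a : 'I_m -> R) (p : 'I_m -> V),
     [/\ forall i, A (p i), \sum_i a i = 1 & x = \sum_i a i *: p i]].

(* [V] carries the topology of its coordinate space under [v2r]; this does not
   depend on the choice of coordinates. *)
Definition ri A : set V :=
  [set x | A x /\ \forall u \near v2r x, affine_hull A (r2v u) -> A (r2v u)].

Definition is_span A (U : {vspace V}) : Prop :=
  (forall x, A x -> x \in U) /\
  (forall U' : {vspace V}, (forall x, A x -> x \in U') -> (U <= U')%VS).

Definition closed_ray A : Prop :=
  exists v : V, v != 0 /\ A = [set t *: v | t in [set t : R | 0 <= t]].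

(* For a set S of invertible endomorphisms, [(f^-1)%VF] is the inverse of f. *)
Inductive generated (S : set 'End(V)) : 'End(V) -> Prop :=
| gen_id : generated S \1%VF
| gen_in f : S f -> generated S f
| gen_mul f g : generated S f -> generated S g -> generated S (f \o g)%VF
| gen_inv f : generated S f -> generated S (f^-1)%VF.

Lemma Fa0 K F : K 0 -> Fa K F -> F 0.
Proof.
move=> K0 [[_ FK HF] [x Fx]]; apply: contrapT => F0.
by have [] := HF 0 x (conj K0 F0) (FK _ Fx); rewrite add0r.
Qed.

Lemma face_joinP K F G : convex_cone K -> K 0 -> F `<=` K -> G `<=` K ->
  [/\ Fa K (face_join K F G), F `<=` face_join K F G,
      G `<=` face_join K F G &
      forall E, Fa K E -> F `<=` E -> G `<=` E -> face_join K F G `<=` E].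
Proof.
move=> Kcone K0 FK GK.
have FaK : Fa K K.
  by split; [split=> // x y [] | exists 0].
split; first 1 last.
- by move=> x Fx E _ FE _; exact: FE.
- by move=> x Gx E _ _ GE; exact: GE.
- by move=> E FaE FE GE x; apply.
split; last by exists 0 => E FaE _ _; exact: Fa0 FaE.
split.
- split=> [x y Jx Jy E FaE FE GE | t x t0 Jx E FaE FE GE];
    have [[[EA EM] _ _] _] := FaE.
  + by apply: EA; [exact: Jx | exact: Jy].
  + by apply: EM => //; exact: Jx.
- by move=> x; apply.
- move=> x y [Kx nJx] Ky; split; first by apply: Kcone.1.
  move=> Jxy; apply: nJx => E FaE FE GE; apply: contrapT => nEx.
  have [[_ _ HE] _] := FaE.
  by have [_] := HE x y (conj Kx nEx) Ky; apply; exact: Jxy.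
Qed.

End Convex.

Section LinearCoxeter.
Context {R : realType} {h : vectType R}.
Local Notation dual := 'Hom(h, R^o).

Section Ray.
Implicit Types (H : set h) (L : set dual).

Definition ray_ge0 H : set dual :=
  [set l | forall x, H x -> 0 <= (l x : R)].
Definition ray_gt0 H : set dual :=
  [set l | forall x, H x -> x != 0 -> 0 < (l x : R)].
Definition ray_eq0 H : set dual :=
  [set l | forall x, H x -> l x = 0].

Definition is_reflection H L (s : 'End(dual)) : Prop :=
  (forall l, ray_eq0 H l -> s l = l) /\ (forall l, L l -> s l = - l).

(* The reflection at [ray_eq0 H] along the line [L `|` -L]; see reflectionP and
   is_reflection_uniq. *)
Definition reflection H L : 'End(dual) := xget \1%VF (is_reflection H L).

Definition root_data H L : Prop :=
  [/\ closed_ray H, closed_ray L & L `\ 0 `<=` ray_gt0 H].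

Lemma reflectionP H L : root_data H L -> is_reflection H L (reflection H L).
Proof.
move=> [[v [v0 HE]] [a [a0 LE]] LH]; apply: xgetPex.
have Hv : H v by rewrite HE; exists 1; rewrite /= ?ler01 ?scale1r.
have La : L a by rewrite LE; exists 1; rewrite /= ?ler01 ?scale1r.
have av : 0 < (a v : R) by apply: LH => //; split=> //; exact/eqP.
pose f (l : dual) : dual := l - ((2 : R) * (l v : R) / (a v : R)) *: a.
have flin : linear f.
  move=> c l m; rewrite /f add_lfunE scale_lfunE scalerBr scalerA.
  rewrite addrACA -opprD -scalerDl; congr (_ - _ *: _).
  by rewrite mulrDr mulrDl /GRing.scale /= !mulrA [c * 2]mulrC.
pose fL := GRing.isLinear.Build _ _ _ _ f flin.
pose fl : {linear dual -> dual} := HB.pack f fL.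
exists (linfun fl); split=> l.
- by move=> l0; rewrite lfunE /= /f (l0 v Hv) mulr0 mul0r scale0r subr0.
- rewrite LE => -[t _ <-]; rewrite lfunE /= /f.
  have -> : ((t *: a) v : R) = t * (a v : R) by rewrite scale_lfunE.
  rewrite mulrA mulfK ?gt_eqF // -scalerBl.
  have -> : t - 2 * t = - t by rewrite mulr_natl mulr2n opprD addrA subrr sub0r.
  by rewrite scaleNr.
Qed.

Lemma is_reflection_uniq H L s s' : root_data H L ->
  is_reflection H L s -> is_reflection H L s' -> s = s'.
Proof.
move=> [[v [v0 HE]] [a [a0 LE]] LH] [sH sL] [s'H s'L].
have Hv : H v by rewrite HE; exists 1; rewrite /= ?ler01 ?scale1r.
have La : L a by rewrite LE; exists 1; rewrite /= ?ler01 ?scale1r.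
have av : 0 < (a v : R) by apply: LH => //; split=> //; exact/eqP.
apply/lfunP => l.
pose c : R := (l v : R) / (a v : R).
have l0 : ray_eq0 H (l - c *: a).
  move=> x; rewrite HE => -[t _ <-].
  rewrite linearZ /= add_lfunE opp_lfunE scale_lfunE /c.
  by rewrite /GRing.scale /= mulfVK ?gt_eqF // subrr mulr0.
have sE m : s (l - c *: a + m) = s (l - c *: a) + s m by rewrite linearD.
have s'E m : s' (l - c *: a + m) = s' (l - c *: a) + s' m by rewrite linearD.
rewrite -[l](subrK (c *: a)) sE s'E (sH _ l0) (s'H _ l0) !linearZ /=.
by rewrite (sL _ La) (s'L _ La).
Qed.

End Ray.

Section System.
Context {n : nat}.
Variables (H : 'I_n -> set h) (L : 'I_n -> set dual).
Implicit Types (J K : set 'I_n) (s t : 'End(dual)) (w : seq 'I_n).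

Definition closed_chamber : set dual := \bigcap_i ray_ge0 (H i).
Definition chamber : set dual := \bigcap_i ray_gt0 (H i).

Definition srefl (i : 'I_n) : 'End(dual) := reflection (H i) (L i).

Definition parabolic J : set 'End(dual) := generated (srefl @` J).
Definition coxeter_group : set 'End(dual) := parabolic setT.

Definition wall (i : 'I_n) : set dual :=
  closed_chamber `&` ray_eq0 (H i).

Definition codim1 (F : set dual) : Prop :=
  exists U, is_span F U /\ (\dim U).+1 = \dim {: dual}.

Record linear_coxeter_system : Prop := LinearCoxeterSystem {
  lcs_rank : (0 < n)%N;
  lcs_rays : forall i, root_data (H i) (L i);
  lcs_span : is_span closed_chamber fullv;
  lcs_facets : forall F,
    Fa closed_chamber F /\ codim1 F <-> exists i, F = wall i;
  lcs_inj : injective wall;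
  lcs_free : forall s, coxeter_group s -> s <> \1%VF ->
    (s @` chamber) `&` chamber = set0 }.

Definition tits_cone : set dual :=
  \bigcup_(s in coxeter_group) (s @` closed_chamber).

Definition word w : 'End(dual) :=
  foldr (fun i s => (srefl i \o s)%VF) \1%VF w.

Definition reduced w : Prop :=
  forall w', word w' = word w -> (size w <= size w')%N.

(* Only meaningful on [coxeter_group] (value 0 elsewhere). *)
Definition cox_length s : nat :=
  xget 0%N [set k | exists w, [/\ word w = s, reduced w & size w = k]].

Definition min_double_coset J K : set 'End(dual) :=
  [set t | coxeter_group t /\
     forall a b, parabolic J a -> parabolic K b ->
       (cox_length t <= cox_length (a \o (t \o b))%VF)%N].

(* All reduced words of s have the same letters, so any of them may be used. *)
Definition red s : set 'I_n :=
  [set i | exists w, [/\ word w = s, reduced w & i \in w]].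

Definition Upsilon (Y : set dual) : set (set dual) :=
  [set F | Fa Y F /\ (ri F `&` closed_chamber) !=set0].

Definition upsilon (F : set dual) : set 'I_n :=
  [set i | srefl i @` F = F].
Definition upsilon_lo (F : set dual) : set 'I_n :=
  [set i | forall x, F x -> srefl i x = x].
Definition upsilon_up (F : set dual) : set 'I_n :=
  upsilon F `\` upsilon_lo F.

End System.
End LinearCoxeter.

Definition is_biggest {T : Type} (S : set (set T)) (A : set T) : Prop :=
  S A /\ forall B, S B -> B `<=` A.
Definition is_smallest {T : Type} (S : set (set T)) (A : set T) : Prop :=
  S A /\ forall B, S B -> A `<=` B.

(* Main.v *)
(* A face is controlled by any point of its relative interior: a face meeting
   [ri G] contains the cone [G], and if [srefl i] fixes a point of [ri F], then it
   maps the face [F] to itself.  Hence for [F] in Upsilon, the i-th coroot is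
   nonnegative on [F] unless [i] is in [upsilon F], and [upsilon_up F] consists of
   the [i] whose coroot takes a negative value on [F].

   (a) A point of [R1 `&` tau R2] is [a l] with [a] in [W_(upsilon R1)] and [l] in
   the closed chamber, [R1] and [R2], such that some [a' tau b'], with [a'] and [b']
   in the two parabolic subgroups, fixes [l].  This product can be taken reduced,
   so the letters of [tau] fix [l].  Applied to a point of the relative interior
   of the meet, this shows that [l] again lies in that relative interior.

   (b) If [x] and [y] are in the closed chamber and in [ri R1] and [ri R2], then
   [x + s *: tau y] lies, for small [s], in the closed chamber and in the relative
   interior of the join.  For every suffix [i :: v] of a reduced word of [tau], the
   i-th coroot is negative at [word (i :: v) y], so that one letter of [tau] after
   the other belongs to [upsilon_up] of the join.

   The Coxeter group theory needed (exchange, deletion, stabilizers) follows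
   directly from the freeness of the action on the open chamber: a translate of
   the chamber cannot cross a reflecting hyperplane, since the reflection would
   then map this translate to one that it meets. *)

From HB Require Import structures.
Require Import Defs.
From mathcomp Require Import all_boot all_order all_algebra.
From mathcomp Require Import all_classical all_reals all_analysis.
From mathcomp Require Import ring lra.

Set Implicit Arguments.
Unset Strict Implicit.
Unset Printing Implicit Defensive.

Import Order.TTheory GRing.Theory Num.Theory.
Import VectorInternalTheory.
Import numFieldNormedType.Exports.

Local Open Scope classical_set_scope.
Local Open Scope ring_scope.

(** * Subsequences and small positive parameters *)

Lemma subseq_cat_split (T : eqType) (w u v : seq T) : subseq w (u ++ v) ->
  exists u' v', [/\ subseq u' u, subseq v' v & w = u' ++ v'].
Proof.
move=> /subseqP[m]; rewrite size_cat => sm ->.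
exists (mask (take (size u) m) u), (mask (drop (size u) m) v).
rewrite !mask_subseq -mask_cat ?cat_take_drop //.
by rewrite size_takel // sm leq_addr.
Qed.

Lemma near_right_addM_gt0 (R : realType) (a b : R) : 0 < a ->
  \forall t \near 0^'+, 0 < a + t * b.
Proof.
move=> a0; have b1 : 0 < 1 + `|b| by rewrite ltr_pwDl.
have c0 : 0 < a / (1 + `|b|) by rewrite divr_gt0.
near=> t.
have t0 : 0 < t by near: t; exact: nbhs_right_gt.
have : t < a / (1 + `|b|) by near: t; exact: nbhs_right_lt.
rewrite ltr_pdivlMr // => ta.
have : - `|b| <= b by rewrite lerNl -normrN ler_norm.
by move=> /(ler_wpM2l (ltW t0)); lra.
Unshelve. all: end_near. Qed.

Lemma near_right_ex (R : realType) (P : R -> Prop) :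
  (\forall t \near 0^'+, P t) -> exists2 t, 0 < t & P t.
Proof.
move=> HP; have [t [t0 Pt]] : exists t : R, 0 < t /\ P t.
  by apply: (@filter_ex _ (0 : R)^'+); near=> t; split; near: t;
    [exact: nbhs_right_gt | exact: HP].
by exists t.
Unshelve. all: end_near. Qed.

(** * Relative interiors and faces of convex cones *)

Section Cone.
Context {R : realType} {V : vectType R}.
Implicit Types (K F G : set V) (X : seq V).

(** The relative interior in algebraic form; [ri_coneE] identifies it with [ri] on convex cones. *)
Definition core K : set V :=
  [set x | K x /\ forall y, K y -> exists2 t : R, 0 < t & K (x - t *: y)].

(** The base point [z] stands in for 0, which a cone may fail to contain. *)
Lemma cone_sum K X (a : nat -> R) z : convex_cone K -> K z ->
  (forall i, (i < size X)%N -> 0 < a i) -> (forall x, x \in X -> K x) ->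
  K (z + \sum_(i < size X) a i *: X`_i).
Proof.
move=> [KD KZ] Kz a0 KX; elim/big_ind: _ z Kz => [|u v Hu Hv|i _] z Kz.
- by rewrite addr0.
- by rewrite addrA; apply: Hv; apply: Hu.
- by apply: KD => //; apply: KZ; [exact: a0 | apply: KX; rewrite mem_nth].
Qed.

Lemma cone_spanning K : exists X : seq V,
  (forall x, x \in X -> K x) /\ forall x, K x -> x \in <<X>>%VS.
Proof.
(* [m] bounds the codimension of the span of [X]. *)
suff H m (X : seq V) : (forall x, x \in X -> K x) ->
    (\dim {:V} <= \dim <<X>> + m)%N -> exists X : seq V,
    (forall x, x \in X -> K x) /\ forall x, K x -> x \in <<X>>%VS.
  by apply: (H (\dim {:V}) [::]) => //; rewrite leq_addl.
elim: m X => [|m IH] X KX dX.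
  exists X; split=> // x _; rewrite addn0 in dX.
  have := dimv_leqif_eq (subvf <<X>>%VS).
  by case=> _; rewrite eqn_leq dX (dimvS (subvf _)) => /esym/eqP ->; rewrite memvf.
case: (pselect (forall x, K x -> x \in <<X>>%VS)) => [|/existsNP[x]].
  by exists X.
move=> /not_implyP[Kx /negP nx].
apply: (IH (x :: X)).
  by move=> y; rewrite inE => /orP[/eqP ->|/KX].
rewrite (leq_trans dX) // addnS -addSn leq_add2r.
have /dimv_leqif_eq[le eqE] : (<<X>> <= <<x :: X>>)%VS.
  by rewrite span_cons addvSr.
rewrite ltn_neqAle le andbT eqE.
by apply: contra nx => /eqP ->; rewrite memv_span // mem_head.
Qed.

(** Some multiple [t] of all generators can be subtracted within [K]; the positive coefficients
    [t + d i] then add them back. So a lower bound on [d] suffices. *)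
Lemma core_sum_near K X x : convex_cone K -> core K x ->
  (forall y, y \in X -> K y) ->
  exists2 t : R, 0 < t & forall d : nat -> R,
    (forall i, (i < size X)%N -> - t < d i) ->
    K (x + \sum_(i < size X) d i *: X`_i).
Proof.
move=> cK [Kx Hx] KX.
have [|t t0 Kt] := Hx (x + \sum_(i < size X) X`_i).
  have := @cone_sum K X (fun=> 1) x cK Kx (fun _ _ => ltr01) KX.
  by under eq_bigr do rewrite scale1r.
have {}Kt : K (x - t *: \sum_(i < size X) X`_i).
  rewrite scalerDr opprD in Kt.
  have := cK.1 _ _ (cK.2 t x t0 Kx) Kt.
  by congr K; rewrite addrCA [t *: x + _]addrA subrr add0r.
exists t => // d dt.
have := @cone_sum K X (fun i => t + d i) _ cK Kt.
have -> : \sum_(i < size X) (t + d i) *: X`_i =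
    t *: (\sum_(i < size X) X`_i) + \sum_(i < size X) d i *: X`_i.
  by rewrite scaler_sumr -big_split; apply: eq_bigr => i _; rewrite scalerDl.
rewrite addrA subrK; apply=> // i /dt; lra.
Qed.

Lemma memv_span_sum X y : y \in <<X>>%VS ->
  exists d : nat -> R, y = \sum_(i < size X) d i *: X`_i.
Proof.
move=> Xy.
exists (fun i => if insub i is Some j then coord (in_tuple X) j y else 0).
rewrite {1}(coord_span (X := in_tuple X) Xy).
by apply: eq_bigr => i _; rewrite valK.
Qed.

(** In [x0] plus a spanning family, subtracting a small multiple of a point of [K] keeps the
    coefficients, initially 1, positive. *)
Lemma core_cone_ex K : convex_cone K -> K !=set0 -> exists x, core K x.
Proof.
move=> cK [x0 Kx0]; have [X [KX KsX]] := cone_spanning K.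
have Kx : K (x0 + \sum_(i < size X) (1 : R) *: X`_i).
  exact: (@cone_sum K X (fun=> 1) x0 cK Kx0 (fun _ _ => ltr01) KX).
exists (x0 + \sum_(i < size X) (1 : R) *: X`_i); split=> // y Ky.
have [d yE] := memv_span_sum (KsX y Ky).
have [t t0 Ht] : exists2 t : R, 0 < t & forall i : 'I_(size X), 0 < 1 + t * - d i.
  apply: near_right_ex; apply: filter_forall => i.
  exact: near_right_addM_gt0.
exists t => //; rewrite yE scaler_sumr -sumrN -addrA -big_split /=.
under eq_bigr do rewrite scalerA -scaleNr -scalerDl -mulrN.
apply: (@cone_sum K X (fun i => 1 + t * - d i)) => // i Hi.
exact: (Ht (Ordinal Hi)).
Qed.

Lemma affine_hull_span K (U : {vspace V}) x :
  (forall y, K y -> y \in U) -> affine_hull K x -> x \in U.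
Proof.
move=> KU [m [a [p [Kp _ ->]]]]; apply: rpred_sum => i _.
by apply: rpredZ; exact: KU.
Qed.

Lemma affine_hull2 K x y (s : R) :
  K x -> K y -> affine_hull K (x + s *: (x - y)).
Proof.
move=> Kx Ky; exists 2%N, (fun i => if i == ord0 then 1 + s else - s).
exists (fun i => if i == ord0 then x else y); split=> [i||].
- by case: ifP.
- by rewrite !big_ord_recl big_ord0 /= addr0 addrK.
- rewrite !big_ord_recl big_ord0 /= addr0 scalerDl scale1r scaleNr.
  by rewrite scalerBr addrA.
Qed.

Lemma v2r_coord_near (x : V) (f : {scalar V}) (e : R) : 0 < e ->
  \forall u \near v2r x, - e < f (r2v u - x).
Proof.
move=> e0.
have fE u : f (r2v u - x) =
    \sum_(k < dim V) u 0 k * f (r2v (delta_mx 0 k)) - f x.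
  rewrite linearB /= {1}[u]row_sum_delta !linear_sum /=; congr (_ - _).
  by apply: eq_bigr => k _; rewrite !linearZ.
have cont : continuous (fun u : 'rV[R]_(dim V) =>
    \sum_(k < dim V) u 0 k * f (r2v (delta_mx 0 k)) - f x).
  move=> u; apply: (@cvgB _ _ _ (nbhs u)); last exact: cvg_cst.
  apply: cvg_big => [|k _]; first exact: add_continuous.
  apply: cvgM; last exact: cvg_cst.
  exact: coord_continuous.
have /cvgr_gt/(_ (- e)) := cont (v2r x).
rewrite -fE v2rK subrr linear0 oppr_lt0 => /(_ e0); apply: filterS => u.
by rewrite fE.
Qed.

(** From [ri] to [core]: prolong the segment from [y] to [x] slightly beyond [x] and rescale by
    [1 / (1 + s)]. Conversely, nearby points of the affine hull differ from [x] by small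
    coefficients on a spanning family. *)
Lemma ri_coneE K : convex_cone K -> ri K = core K.
Proof.
move=> cK; apply/seteqP; split=> x [Kx Hx]; split=> //.
  move=> y Ky.
  have cv : (fun s : R => v2r x + s *: v2r (x - y)) @ (0 : R)^'+ --> v2r x.
    rewrite -[X in _ --> X]addr0; apply: cvgD; first exact: cvg_cst.
    rewrite -[X in _ --> X](scale0r (v2r (x - y))); apply: cvgZ; last exact: cvg_cst.
    exact: cvg_at_right_filter.
  have /near_right_ex[s s0] := cv _ Hx.
  rewrite /= linearD linearZ /= !v2rK => /(_ (affine_hull2 _ Kx Ky)) Ks.
  have s1 : 0 < 1 + s by rewrite addr_gt0.
  exists (s / (1 + s)); first by rewrite divr_gt0.
  have : 0 < (1 + s)^-1 by rewrite invr_gt0.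
  move=> /cK.2 /(_ Ks); congr K.
  rewrite scalerBr addrA -[X in X + _ - _]scale1r -scalerDl scalerBr !scalerA.
  by rewrite mulVf ?gt_eqF // scale1r mulrC.
have [X [KX KsX]] := cone_spanning K.
have [t t0 Ht] := core_sum_near cK (conj Kx Hx) KX.
pose x' : 'rV[R]_(dim V) := v2r x.
apply: filterS (@filter_forall _ _ _ _ (nbhs_filter x')
  (fun i => @v2r_coord_near x (coord (in_tuple X) i) t t0)) => u Hu Ku.
have uX : r2v u - x \in <<X>>%VS.
  by apply: rpredB; [exact: affine_hull_span KsX Ku | exact: KsX].
pose d i := if insub i is Some j then coord (in_tuple X) j (r2v u - x) else 0.
rewrite -[r2v u](subrK x) addrC (coord_span (X := in_tuple X) uX).
rewrite (eq_bigr (fun i : 'I_(size X) => d i *: X`_i)).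
  by apply: Ht => i Hi; rewrite /d insubT; exact: Hu.
by move=> i _; rewrite /d valK.
Qed.

Lemma face_summand K F x y : Fa K F -> K x -> K y -> F (x + y) -> F x.
Proof.
move=> [[_ _ HF] _] Kx Ky Fxy; apply: contrapT => nFx.
by have [] := HF x y (conj Kx nFx) Ky.
Qed.

Lemma coreD K x y : convex_cone K -> core K x -> K y -> core K (x + y).
Proof.
move=> [KD _] [Kx Hx] Ky; split; first exact: KD.
move=> z Kz; have [t t0 Kt] := Hx z Kz; exists t => //.
by rewrite addrAC; exact: KD.
Qed.

Lemma coreZ K (t : R) x : convex_cone K -> 0 < t -> core K x -> core K (t *: x).
Proof.
move=> [_ KZ] t0 [Kx Hx]; split; first exact: KZ.
move=> z Kz; have [s s0 Ks] := Hx z Kz; exists (t * s); first exact: mulr_gt0.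
by rewrite -scalerA -scalerBr; exact: KZ.
Qed.

(** [x] is the sum of [t *: y] and [x - t *: y], both in [K], and a face containing a sum contains
    its summands. *)
Lemma face_core_sub K F G x : Fa K F -> G `<=` K -> convex_cone K ->
  core G x -> F x -> G `<=` F.
Proof.
move=> [[[FD FZ] FK HF] _] GK cK [Gx Hx] Fx y Gy.
have [t t0 Gt] := Hx y Gy.
apply: contrapT => nFy.
have nFt : ~ F (t *: y).
  move=> /(FZ t^-1); rewrite invr_gt0 => /(_ t0).
  by rewrite scalerA mulVf ?gt_eqF // scale1r.
have [_] := HF (t *: y) (x - t *: y) (conj (cK.2 _ _ t0 (GK _ Gy)) nFt) (GK _ Gt).
by rewrite addrC subrK.
Qed.

Lemma generated_face K p : convex_cone K -> K 0 -> K p ->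
  Fa K [set y | K y /\ exists2 t : R, 0 < t & K (p - t *: y)].
Proof.
move=> cK K0 Kp; split; last first.
  by exists 0; split=> //; exists 1 => //; rewrite scaler0 subr0.
split.
- split=> [x y [Kx [t t0 Kt]] [Ky [u u0 Ku]] | r x r0 [Kx [t t0 Kt]]].
    split; first exact: cK.1.
    have tu : 0 < t + u by rewrite addr_gt0.
    (* The convex combination of [p - t *: x] and [p - u *: y] with weights [u / (t + u)] and
       [t / (t + u)] has this multiple of [x + y]. *)
    exists (t * u / (t + u)); first by rewrite divr_gt0 // mulr_gt0.
    have a0 : 0 < u / (t + u) by rewrite divr_gt0.
    have b0 : 0 < t / (t + u) by rewrite divr_gt0.
    have := cK.1 _ _ (cK.2 _ _ a0 Kt) (cK.2 _ _ b0 Ku); congr K.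
    rewrite !scalerBr !scalerA scalerDr opprD addrACA -scalerDl.
    rewrite -mulrDl [u + t]addrC mulfV ?gt_eqF // scale1r.
    by congr (_ + (- (_ *: _) - (_ *: _))); field; rewrite gt_eqF.
  split; first exact: cK.2.
  exists (t / r); first by rewrite divr_gt0.
  by rewrite scalerA mulfVK // gt_eqF.
- by move=> y [].
- move=> x y [Kx nx] Ky; split; first exact: cK.1.
  move=> [_ [t t0 Kt]]; apply: nx; split=> //; exists t => //.
  have := cK.1 _ _ Kt (cK.2 _ _ t0 Ky); congr K.
  by rewrite scalerDr opprD -!addrA addNr addr0.
Qed.

(** By leastness [E] lies in the face generated by [p], so some [p - t *: y] is in [K]; as a summand
    of [p], it is in the face [E]. *)
Lemma core_least_face K E p : convex_cone K -> K 0 -> Fa K E -> E p ->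
  (forall G, Fa K G -> G p -> E `<=` G) -> core E p.
Proof.
move=> cK K0 FE Ep least; split=> // y Ey.
have EK : E `<=` K by case: FE => -[].
have [|_ [t t0 Kt]] := least _ (generated_face cK K0 (EK _ Ep)) _ y Ey.
  split; first exact: EK.
  by exists 1 => //; rewrite scale1r subrr.
exists t => //; apply: contrapT => nE.
have [[[_ EZ] _ HE] _] := FE.
have [_] := HE _ _ (conj Kt nE) (cK.2 _ _ t0 (EK _ Ey)).
by rewrite subrK.
Qed.

Lemma Fa_image K F (g : 'End(V)) : injective g -> g @` K = K ->
  Fa K F -> Fa K (g @` F).
Proof.
move=> gI gK [[[FD FZ] FK HF] [x0 Fx0]]; split; last by exists (g x0), x0.
have gKi x : K (g x) -> K x by rewrite -{1}gK => -[y Ky /gI <-].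
split.
- split=> [_ _ [x Fx <-] [y Fy <-] | t _ t0 [x Fx <-]].
    by exists (x + y); [exact: FD | rewrite linearD].
  by exists (t *: x); [exact: FZ | rewrite linearZ].
- by rewrite -gK; exact: image_subset.
- move=> x y; rewrite -gK => -[[u Ku <-] nu] [v Kv <-].
  have [|K1 K2] := HF u v _ Kv; first by split=> // Fu; apply: nu; exists u.
  rewrite -linearD; split; first by exists (u + v).
  by move=> [w Fw /gI wE]; apply: K2; rewrite -wE.
Qed.

Lemma core_image K (g : 'End(V)) x : core K x -> core (g @` K) (g x).
Proof.
move=> [Kx Hx]; split; first by exists x.
move=> _ [y Ky <-]; have [t t0 Kt] := Hx y Ky.
by exists t => //; exists (x - t *: y); rewrite // linearB linearZ.
Qed.

Lemma FaI K F G : K 0 -> Fa K F -> Fa K G -> Fa K (F `&` G).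
Proof.
move=> K0 FF FG; split; last by exists 0; split; exact: (Fa0 K0).
have [[[FD FZ] FK HF] _] := FF; have [[[GD GZ] GK HG] _] := FG.
split.
- split=> [x y [Fx Gx] [Fy Gy]|t x t0 [Fx Gx]].
    by split; [exact: FD | exact: GD].
  by split; [exact: FZ | exact: GZ].
- by move=> x [/FK].
- move=> x y [Kx /not_andP nFG] Ky; case: nFG => n.
    by have [Kxy nxy] := HF x y (conj Kx n) Ky; split=> // -[].
  by have [Kxy nxy] := HG x y (conj Kx n) Ky; split=> // -[].
Qed.

(* As [g] preserves dimensions, [F] and [g @` F] span the same subspace. *)
Lemma face_image_sub_eq K F (g : 'End(V)) : injective g -> convex_cone K ->
  convex_cone F -> F `<=` K -> Fa K (g @` F) -> g @` F `<=` F ->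
  F `<=` g @` F.
Proof.
move=> gI cK cF FK Fg gF.
have [X [FX FsX]] := cone_spanning F.
have [_ [_ [z0 Fz0 _]]] := Fg.
have [z Fz] := core_cone_ex cF (ex_intro _ z0 Fz0).
have gXF y : y \in map g X -> (g @` F) y.
  by move=> /mapP[w /FX Fw ->]; exists w.
have XE : <<map g X>>%VS = <<X>>%VS.
  apply/eqP; rewrite eqEdim; apply/andP; split.
    by apply/span_subvP => y /gXF/gF/FsX.
  rewrite -limg_span limg_dim_eq //.
  by have /lker0P/eqP -> := gI; rewrite capv0.
have cgF : convex_cone (g @` F) by case: Fg => -[].
have [t t0 Ht] := core_sum_near cgF (core_image g Fz) gXF.
(* It suffices that [g z] is in the core of [F]. As [map g X] spans the same space as [F], a small
   multiple of any point of [F] can be subtracted from [g z] within the image of [F]. *)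
apply: (face_core_sub Fg FK cK (x := g z)); last first.
  by exists z; first exact: Fz.1.
split; first by apply: gF; exists z; first exact: Fz.1.
move=> y Fy.
have /memv_span_sum[d yE] : y \in <<map g X>>%VS by rewrite XE; exact: FsX.
have [r r0 Hr] : exists2 r : R, 0 < r &
    forall i : 'I_(size (map g X)), 0 < t + r * - d i.
  apply: near_right_ex; apply: filter_forall => i.
  exact: near_right_addM_gt0.
exists r => //; apply: gF.
rewrite yE scaler_sumr -sumrN.
under eq_bigr do rewrite scalerA -scaleNr.
apply: (Ht (fun i => - (r * d i))) => i Hi.
by have /= := Hr (Ordinal Hi); lra.
Qed.

End Cone.

(** * Exchange, deletion and stabilizers *)

Section CoxeterGroup.
Context {R : realType} {h : vectType R} {n : nat}.
Local Notation dual := 'Hom(h, R^o).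
Variables (H : 'I_n -> set h) (L : 'I_n -> set dual).
Hypothesis lcs : linear_coxeter_system H L.
Implicit Types (i j k : 'I_n) (l x y : dual) (u v w : seq 'I_n) (J : set 'I_n).

Local Notation srefl := (srefl H L).
Local Notation word := (word H L).
Local Notation reduced := (reduced H L).
Local Notation chamber := (chamber H).
Local Notation closed_chamber := (closed_chamber H).

(** Determined up to a positive factor, so the signs of pairings do not depend on the choice. *)
Definition coroot i : h :=
  xget 0 [set v | v != 0 /\ H i = [set t *: v | t in [set t : R | 0 <= t]]].

Definition pairing i l : R := l (coroot i).

Lemma pairingD i x y : pairing i (x + y) = pairing i x + pairing i y.
Proof. by rewrite /pairing add_lfunE. Qed.

Lemma pairingZ i (t : R) x : pairing i (t *: x) = t * pairing i x.
Proof. by rewrite /pairing scale_lfunE. Qed.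

Lemma pairingN i x : pairing i (- x) = - pairing i x.
Proof. by rewrite /pairing opp_lfunE. Qed.

Lemma pairing0 i : pairing i 0 = 0.
Proof. by rewrite /pairing zero_lfunE. Qed.

Lemma corootP i :
  coroot i != 0 /\ H i = [set t *: coroot i | t in [set t : R | 0 <= t]].
Proof.
have [[v [v0 HE]] _ _] := lcs_rays lcs i.
exact: (@xgetPex _ 0 [set v | v != 0 /\
  H i = [set t *: v | t in [set t : R | 0 <= t]]] (ex_intro _ v (conj v0 HE))).
Qed.

Lemma in_ray_coroot i : H i (coroot i).
Proof.
by have [_ ->] := corootP i; exists 1; rewrite /= ?ler01 ?scale1r.
Qed.

Lemma ray_ge0E i l : ray_ge0 (H i) l <-> 0 <= pairing i l.
Proof.
split=> [|l0 x]; first by apply; exact: in_ray_coroot.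
have [_ ->] := corootP i; move=> [t t0 <-].
by rewrite linearZ mulr_ge0.
Qed.

Lemma ray_gt0E i l : ray_gt0 (H i) l <-> 0 < pairing i l.
Proof.
have [c0 HE] := corootP i.
split=> [|l0 x]; first by apply=> //; exact: in_ray_coroot.
rewrite HE => -[t t0 <-] tc0; rewrite linearZ mulr_gt0 // lt_neqAle t0 andbT.
by apply: contra tc0 => /eqP <-; rewrite scale0r.
Qed.

Lemma ray_eq0E i l : ray_eq0 (H i) l <-> pairing i l = 0.
Proof.
split=> [|l0 x]; first by apply; exact: in_ray_coroot.
have [_ ->] := corootP i; move=> [t t0 <-].
by rewrite linearZ /= [l _]l0 scaler0.
Qed.

Lemma closed_chamberE l : closed_chamber l <-> forall i, 0 <= pairing i l.
Proof.
by split=> [Cl i|Cl i _]; apply/ray_ge0E; [exact: Cl | exact: Cl].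
Qed.

Lemma chamberE l : chamber l <-> forall i, 0 < pairing i l.
Proof.
by split=> [Cl i|Cl i _]; apply/ray_gt0E; [exact: Cl | exact: Cl].
Qed.

Lemma sreflE i : exists2 a, pairing i a = 2 &
  forall l, srefl i l = l - pairing i l *: a.
Proof.
have rd := lcs_rays lcs i.
have [_ [b [b0 LE]] LH] := rd.
have Lb : L i b by rewrite LE; exists 1; rewrite /= ?ler01 ?scale1r.
have pb : 0 < pairing i b.
  by apply/ray_gt0E; apply: LH; split=> //; exact/eqP.
have [fixH negL] := reflectionP rd.
exists ((2 / pairing i b) *: b) => [|l].
  by rewrite pairingZ mulfVK // gt_eqF.
pose c := pairing i l / pairing i b.
have l0 : ray_eq0 (H i) (l - c *: b).
  apply/ray_eq0E; rewrite pairingD pairingN pairingZ mulfVK ?gt_eqF //.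
  by rewrite subrr.
have -> : srefl i l = srefl i (l - c *: b) + c *: srefl i b.
  by rewrite -linearZ -linearD subrK.
rewrite /srefl (fixH _ l0) (negL _ Lb) scalerN -addrA -opprD -scalerDl.
congr (_ - _); rewrite scalerA; congr (_ *: _); rewrite /c; field.
by rewrite gt_eqF.
Qed.

Lemma srefl_fix i l : pairing i l = 0 -> srefl i l = l.
Proof.
by move=> l0; have [a _ ->] := sreflE i; rewrite l0 scale0r subr0.
Qed.

Lemma pairing_srefl i l : pairing i (srefl i l) = - pairing i l.
Proof.
have [a a2 ->] := sreflE i; rewrite pairingD pairingN pairingZ a2; lra.
Qed.

Lemma srefl_fixE i l : srefl i l = l <-> pairing i l = 0.
Proof.
split; last exact: srefl_fix.
by move=> E; have := pairing_srefl i l; rewrite E; lra.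
Qed.

Lemma sreflK i : involutive (srefl i).
Proof.
move=> l; have [a a2 sE] := sreflE i.
rewrite !sE pairingD pairingN pairingZ a2 -addrA -opprD -scalerDl.
have -> : pairing i l + (pairing i l - pairing i l * 2) = 0 by ring.
by rewrite scale0r subr0.
Qed.

(** * Words in the simple reflections *)

Lemma word_cat u v : word (u ++ v) = (word u \o word v)%VF.
Proof.
by elim: u => [|i u IH] /=; rewrite ?comp_lfun1l // IH comp_lfunA.
Qed.

Lemma word_catE u v x : word (u ++ v) x = word u (word v x).
Proof. by rewrite word_cat comp_lfunE. Qed.

Lemma word_consE i u x : word (i :: u) x = srefl i (word u x).
Proof. by rewrite /= comp_lfunE. Qed.

Lemma word_rconsE u i x : word (rcons u i) x = word u (srefl i x).
Proof. by rewrite -cats1 word_catE word_consE /= id_lfunE. Qed.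

Lemma word_translate u (t : R) x y :
  word u (x + t *: y) = word u x + t *: word u y.
Proof. by rewrite addrC linearP addrC. Qed.

Lemma word_revl u : (word (rev u) \o word u)%VF = \1%VF.
Proof.
elim: u => [|i u IH]; first by rewrite /= comp_lfun1l.
apply/lfunP => x; rewrite comp_lfunE rev_cons word_rconsE word_consE sreflK.
by rewrite -comp_lfunE IH.
Qed.

Lemma word_revr u : (word u \o word (rev u))%VF = \1%VF.
Proof. by rewrite -{1}[u]revK word_revl. Qed.

Lemma word_revK u : cancel (word u) (word (rev u)).
Proof. by move=> x; rewrite -comp_lfunE word_revl id_lfunE. Qed.

Lemma word_revVK u : cancel (word (rev u)) (word u).
Proof. by move=> x; rewrite -comp_lfunE word_revr id_lfunE. Qed.

Lemma word_inv u : ((word u)^-1)%VF = word (rev u).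
Proof.
have inj : lker (word u) == 0%VS.
  by apply/lker0P; exact: can_inj (word_revK u).
rewrite -[LHS]comp_lfun1r -(word_revr u) comp_lfunA lker0_compVf //.
by rewrite comp_lfun1l.
Qed.

Lemma parabolicP J (s : 'End(dual)) :
  parabolic H L J s <-> exists2 w, (forall i, i \in w -> J i) & word w = s.
Proof.
split.
- elim=> [|f [i Ji <-]|f g _ [u uJ <-] _ [v vJ <-]|f _ [u uJ <-]].
  + by exists [::].
  + by exists [:: i]; rewrite /= ?comp_lfun1r // => j; rewrite inE => /eqP ->.
  + exists (u ++ v); last exact: word_cat.
    by move=> i; rewrite mem_cat => /orP[/uJ|/vJ].
  + by exists (rev u); rewrite ?word_inv // => i; rewrite mem_rev => /uJ.
- move=> [w wJ <-]; elim: w wJ => [_|i w IH wJ]; first exact: gen_id.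
  apply: gen_mul; last by apply: IH => j jw; apply: wJ; rewrite inE jw orbT.
  by apply: gen_in; exists i => //; apply: wJ; rewrite mem_head.
Qed.

Lemma coxeter_word w : coxeter_group H L (word w).
Proof. by apply/parabolicP; exists w. Qed.

Lemma coxeterP s : coxeter_group H L s <-> exists w, word w = s.
Proof.
split=> [/parabolicP[w _ <-]|[w <-]]; first by exists w.
exact: coxeter_word.
Qed.

(** * Points of the chamber and of its facets *)

Lemma closed_chamber_cone : convex_cone closed_chamber.
Proof.
split=> [x y /closed_chamberE Cx /closed_chamberE Cy|t x t0 /closed_chamberE Cx].
  by apply/closed_chamberE => i; rewrite pairingD addr_ge0.
by apply/closed_chamberE => i; rewrite pairingZ mulr_ge0 // ltW.
Qed.

Lemma closed_chamber0 : closed_chamber 0.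
Proof. by apply/closed_chamberE => i; rewrite pairing0. Qed.

(** The witnesses for the single [i] are added up; no summand contributes negatively, since [K] lies
    in the closed chamber. *)
Lemma common_positive (K : set dual) (P : 'I_n -> Prop) :
  convex_cone K -> K 0 -> K `<=` closed_chamber ->
  (forall i, P i -> exists2 x, K x & 0 < pairing i x) ->
  exists2 x, K x & forall i, P i -> 0 < pairing i x.
Proof.
move=> [KD KZ] K0 KC HP.
have /choice[f Hf] : forall i, exists x, K x /\ (P i -> 0 < pairing i x).
  move=> i; have [/HP[x Kx x0]|nP] := pselect (P i); first by exists x.
  by exists 0.
exists (\sum_i f i) => [|i Pi].
  elim/big_ind: _ => // i _; exact: (Hf i).1.
rewrite (bigD1 i) //= pairingD ltr_pwDl //; first exact: (Hf i).2.
have : closed_chamber (\sum_(k < n | k != i) f k).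
  apply: KC; elim/big_ind: _ => // k _; exact: (Hf k).1.
by move=> /closed_chamberE/(_ i).
Qed.

Lemma pairing_kernel i : exists U : {vspace dual},
  forall l, (l \in U) = (pairing i l == 0).
Proof.
pose fL := GRing.isLinear.Build R dual R^o _ (pairing i)
  (fun t x y => etrans (pairingD i _ _) (congr1 (+%R^~ _) (pairingZ i t x))).
pose f : {linear dual -> R^o} := HB.pack (pairing i) fL.
by exists (lker (linfun f)) => l; rewrite memv_ker lfunE.
Qed.

(** A coroot vanishing on the closed chamber would confine this spanning set to a hyperplane. *)
Lemma chamber_ex : exists x, chamber x.
Proof.
have [x _ Hx] : exists2 x, closed_chamber x & forall i, True -> 0 < pairing i x.
  apply: common_positive => //; [exact: closed_chamber_cone |
    exact: closed_chamber0 |] => i _.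
  apply: contrapT => nex; have [U HU] := pairing_kernel i.
  have [_ /(_ U) fU] := lcs_span lcs.
  have /fU/subvP/(_ _ (memvf _)) : forall x, closed_chamber x -> x \in U.
    move=> x Cx; rewrite HU eq_le (proj1 (closed_chamberE x) Cx) andbT leNgt.
    by apply/negP => x0; apply: nex; exists x.
  have [a a2 _] := sreflE i.
  by move=> /(_ a); rewrite HU a2 => /eqP; lra.
by exists x; apply/chamberE => i; exact: Hx.
Qed.

(** If the coroot of [k] vanished on wall [j], this wall would lie in wall [k]; having codimension
    1, both would span the same hyperplane and so coincide. *)
Lemma facet_point j : exists2 x, pairing j x = 0 &
  forall k, k != j -> 0 < pairing k x.
Proof.
have wallE i x : wall H i x <-> closed_chamber x /\ pairing i x = 0.
  by split=> -[Cx x0]; split=> //; exact/ray_eq0E.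
have [[[cW _ _] _] _] := (lcs_facets lcs (wall H j)).2 (ex_intro _ j erefl).
have [|||x /wallE[_ xj] Hx] := @common_positive (wall H j) (fun k => k != j) cW.
- by apply/wallE; split; [exact: closed_chamber0 | exact: pairing0].
- by move=> x [].
- move=> k kj; apply: contrapT => nex; move/eqP: kj; apply; symmetry.
  apply: (lcs_inj lcs).
  have jk : wall H j `<=` wall H k.
    move=> x /[dup] jx /wallE[Cx _]; apply/wallE; split=> //.
    apply/eqP; rewrite eq_le (proj1 (closed_chamberE x) Cx) andbT leNgt.
    by apply/negP => x0; apply: nex; exists x.
  apply/seteqP; split=> // x kx.
  have [_ [Uj [Hj dj]]] := (lcs_facets lcs (wall H j)).2 (ex_intro _ j erefl).
  have [_ [Uk [Hk dk]]] := (lcs_facets lcs (wall H k)).2 (ex_intro _ k erefl).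
  have UE : Uj = Uk.
    apply/eqP; rewrite eqEdim; apply/andP; split.
      by apply: Hj.2 => y /jk /Hk.1.
    by rewrite -ltnS dk -dj.
  have [U HU] := pairing_kernel j.
  have UjU : (Uj <= U)%VS by apply: Hj.2 => y /wallE[_ y0]; rewrite HU y0.
  have := subvP UjU x; rewrite UE => /(_ (Hk.1 _ kx)); rewrite HU => /eqP x0.
  by apply/wallE; split=> //; case/wallE: kx.
- by exists x.
Qed.

(** Otherwise the conjugate of [srefl i] by [word w] fixes [x] and is the identity by freeness,
    although [srefl i] moves every point of the chamber. *)
Lemma word_pairing_neq0 i w x : chamber x -> pairing i (word w x) != 0.
Proof.
move=> Cx; apply/eqP => x0.
pose g := word (rev w ++ i :: w).
have gx : g x = x by rewrite /g word_catE word_consE srefl_fix // word_revK.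
have g1 : g = \1%VF.
  apply: contrapT => g1; have := lcs_free lcs (coxeter_word _) g1.
  by apply/eqP/set0P; exists x; split=> //; exists x.
have [y Cy] := chamber_ex.
have sy : srefl i y = y.
  have := congr1 (fun f : 'End(dual) => word w (f (word (rev w) y))) g1.
  by rewrite /g /= word_catE !word_revVK word_consE word_revVK id_lfunE word_revVK.
have /srefl_fixE y0 := sy.
by have := (chamberE y).1 Cy i; rewrite y0 ltxx.
Qed.

(* Otherwise a point of the segment from [x] to [y] would be mapped by [word w]
   to the hyperplane. *)
Lemma word_pairing_same_side i w x y : chamber x -> closed_chamber y ->
  0 <= pairing i (word w x) * pairing i (word w y).
Proof.
move=> /[dup] Cx /chamberE Cx' /closed_chamberE Cy; rewrite leNgt; apply/negP => xy.
pose a := pairing i (word w x); pose b := pairing i (word w y).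
have Cz (c d : R) : 0 < c -> 0 < d -> a * d + b * c = 0 -> False.
  move=> c0 d0 E.
  have Cz : chamber (d *: x + c *: y).
    apply/chamberE => k; rewrite pairingD !pairingZ ltr_pwDl //.
      by rewrite mulr_gt0.
    by rewrite mulr_ge0 // ltW.
  have := word_pairing_neq0 i w Cz.
  rewrite linearD !linearZ pairingD !pairingZ -/a -/b.
  by rewrite [d * _]mulrC [c * _]mulrC E eqxx.
have [a0|a0] := ltP 0 a.
  have b0 : b < 0 by rewrite -(pmulr_rlt0 _ a0).
  by apply: (Cz a (- b)) => //; [rewrite oppr_gt0 | ring].
have {}a0 : a < 0 by rewrite lt_neqAle a0 andbT; exact: word_pairing_neq0.
have b0 : 0 < b by rewrite -(nmulr_rlt0 _ a0).
by apply: (Cz (- a) b) => //; [rewrite oppr_gt0 | ring].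
Qed.

Lemma chamber_translate x y : (forall k, 0 < pairing k x \/
    0 <= pairing k x /\ 0 < pairing k y) ->
  \forall t \near 0^'+, chamber (x + t *: y).
Proof.
move=> Hxy.
suff : \forall t \near 0^'+, forall k, 0 < pairing k x + t * pairing k y.
  apply: filterS => t Ht; apply/chamberE => k.
  by rewrite pairingD pairingZ.
apply: filter_forall => k; case: (Hxy k) => [|[x0 y0]].
  exact: near_right_addM_gt0.
near=> t; rewrite ltr_wpDl // mulr_gt0 //; near: t.
Unshelve. all: end_near. Qed.

Lemma closed_chamber_translate x y : (forall k, 0 < pairing k x \/
    0 <= pairing k x /\ 0 <= pairing k y) ->
  \forall t \near 0^'+, closed_chamber (x + t *: y).
Proof.
move=> Hxy.
suff : \forall t \near 0^'+, forall k, 0 <= pairing k x + t * pairing k y.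
  apply: filterS => t Ht; apply/closed_chamberE => k.
  by rewrite pairingD pairingZ.
apply: filter_forall => k; case: (Hxy k) => [|[x0 y0]].
  by move=> x0; apply: filterS (near_right_addM_gt0 (pairing k y) x0) => t /ltW.
near=> t; rewrite addr_ge0 // mulr_ge0 // ltW //; near: t.
Unshelve. all: end_near. Qed.

Lemma coxeter_eq1 w x : chamber x -> chamber (word w x) -> word w = \1%VF.
Proof.
move=> Cx Cwx; apply: contrapT => w1.
have := lcs_free lcs (coxeter_word w) w1.
by apply/eqP/set0P; exists (word w x); split=> //; exists x.
Qed.

(* The chambers [w C] and [w s_j C] share the facet [w (wall j)], so a hyperplane
   separating them contains that facet. *)
Lemma word_cross_facet i w j x : chamber x -> 0 < pairing i (word w x) ->
  pairing i (word (rcons w j) x) < 0 -> word (i :: w) = word (rcons w j).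
Proof.
move=> Cx wx wjx; have [x0 jx0 kx0] := facet_point j.
have face0 y : closed_chamber y -> pairing j y = 0 -> pairing i (word w y) = 0.
  move=> Cy jy; apply/eqP; rewrite eq_le; apply/andP; split.
    have := word_pairing_same_side i (rcons w j) Cx Cy.
    by rewrite nmulr_rge0 // word_rconsE (srefl_fix jy).
  by have := word_pairing_same_side i w Cx Cy; rewrite pmulr_rge0.
have x0k k : 0 < pairing k x0 \/ pairing k x0 = 0 /\ k = j.
  by have [->|/kx0] := eqVneq k j; [right | left].
have Cx0 : closed_chamber x0.
  by apply/closed_chamberE => k; case: (x0k k) => [/ltW|[-> _]].
(* [x0] is interior to the facet, so for small [t] the point [x0 + t *: y] stays in it; vanishing
   extends from the facet to its hyperplane. *)
have ker0 y : pairing j y = 0 -> pairing i (word w y) = 0.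
  move=> jy; have [|t t0 Ct] := @near_right_ex R (fun t => closed_chamber (x0 + t *: y)).
    apply: closed_chamber_translate => k; case: (x0k k) => [?|[-> ->]]; first by left.
    by rewrite jy; right.
  have := face0 _ Ct; rewrite word_translate !pairingD !pairingZ jy jx0.
  rewrite (face0 _ Cx0 jx0) !add0r mulr0 => /(_ erefl)/eqP.
  by rewrite mulf_eq0 gt_eqF //= => /eqP.
have jx : 0 < pairing j x by exact: (chamberE x).1.
have propE y : pairing i (word w y) = pairing j y / pairing j x * pairing i (word w x).
  have := @ker0 (y + (- (pairing j y / pairing j x)) *: x).
  rewrite word_translate !pairingD !pairingZ !mulNr mulfVK ?gt_eqF // subrr.
  by move=> /(_ erefl)/eqP; rewrite subr_eq0 => /eqP.
(* This element fixes [x0] and keeps [x] on the positive side of [j]. Hence it maps some chamber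
   point near [x0] into the chamber and is the identity by freeness. *)
pose g := rev w ++ i :: rcons w j.
have gx0 : word g x0 = x0.
  by rewrite word_catE word_consE word_rconsE srefl_fix // srefl_fix ?ker0 // word_revK.
have gx : 0 < pairing j (word g x).
  have := propE (word g x).
  rewrite word_catE word_revVK word_consE pairing_srefl => E.
  have : 0 < - pairing i (word (rcons w j) x) by rewrite oppr_gt0.
  by rewrite E pmulr_lgt0 // pmulr_lgt0 // invr_gt0.
have [|t t0 [Ct Cgt]] := @near_right_ex R
    (fun t => chamber (x0 + t *: x) /\ chamber (x0 + t *: word g x)).
  near=> t; split; near: t; apply: chamber_translate => k;
    case: (x0k k) => [?|[-> ->]]; (try by left); right; split=> //.
have : word g = \1%VF.
  by apply: (coxeter_eq1 Ct); rewrite word_translate gx0.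
move=> g1; apply/lfunP => y.
have := congr1 (fun f : 'End(dual) => word w (f (srefl j y))) g1.
rewrite /g word_catE word_revVK id_lfunE word_consE word_rconsE sreflK.
by rewrite word_consE word_rconsE => ->.
Unshelve. all: end_near. Qed.

(** Along the prefixes of [w] the sign at [i] changes from positive to negative; [word_cross_facet]
    allows the letter at the crossing to be deleted. *)
Lemma exchange i w x : chamber x -> pairing i (word w x) < 0 ->
  exists w', [/\ subseq w' w, (size w' < size w)%N & word (i :: w) = word w'].
Proof.
move=> Cx; elim/last_ind: w => [|w j IH] wx.
  by have := (chamberE x).1 Cx i; rewrite ltNge ltW //; move: wx; rewrite id_lfunE.
have [wx0|wx0|/eqP] := ltgtP (pairing i (word w x)) 0.
- have [w' [sw lw E]] := IH wx0.
  exists (rcons w' j); split; first by rewrite -!cats1 cat_subseq.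
    by rewrite !size_rcons ltnS.
  by apply/lfunP => y; rewrite word_consE !word_rconsE -word_consE E.
- exists w; split; [exact: subseq_rcons | by rewrite size_rcons |].
  have E := word_cross_facet Cx wx0 wx.
  apply/lfunP => y; rewrite word_consE word_rconsE.
  have := congr1 (fun f : 'End(dual) => f (srefl j y)) E.
  by rewrite word_consE word_rconsE sreflK.
- by rewrite (negPf (word_pairing_neq0 _ _ Cx)).
Qed.

(** * Reduced words *)

Lemma word_tail_reduced i w : reduced (i :: w) -> reduced w.
Proof.
move=> rw w' E; rewrite -ltnS; apply: (rw (i :: w')).
by rewrite /= E.
Qed.

Lemma reduced_pairing_lt0 i w x : reduced (i :: w) -> chamber x ->
  pairing i (word (i :: w) x) < 0.
Proof.
move=> rw Cx; rewrite word_consE pairing_srefl oppr_lt0.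
rewrite lt_neqAle eq_sym word_pairing_neq0 //= leNgt; apply/negP => wx.
have [w' [_ lw E]] := exchange Cx wx.
by have := rw w' (esym E); rewrite leqNgt /= ltnS ltnW.
Qed.

Lemma deletion w : ~ reduced w ->
  exists w', [/\ subseq w' w, (size w' < size w)%N & word w' = word w].
Proof.
elim: w => [|i w IH] nr; first by case: nr.
have [rw|/IH[w' [sw lw E]]] := pselect (reduced w); last first.
  by exists (i :: w'); rewrite /= eqxx E.
have [x Cx] := chamber_ex.
have [wx|wx|/eqP] := ltgtP (pairing i (word w x)) 0.
- have [w' [sw lw E]] := exchange Cx wx.
  exists w'; split=> //; last by rewrite /= ltnS ltnW.
  exact: subseq_trans sw (subseq_cons _ _).
(* A shorter word [v] for the same element would be negative at [i], and exchange would yield a word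
   for [word w] shorter than the reduced [w]. *)
- exfalso; apply: nr => v E; rewrite ltnNge; apply/negP => lv.
  have vx : pairing i (word v x) < 0.
    by rewrite E word_consE pairing_srefl oppr_lt0.
  have [v' [_ lv' E']] := exchange Cx vx.
  have /rw : word v' = word w.
    apply/lfunP => y; rewrite -E' word_consE E word_consE sreflK //.
  by rewrite leqNgt (leq_trans lv').
- by rewrite (negPf (word_pairing_neq0 _ _ Cx)).
Qed.

Lemma reduced_subword w :
  exists w', [/\ subseq w' w, reduced w' & word w' = word w].
Proof.
elim/(@ltn_ind): {w}(size w) {-2}w (leqnn (size w)) => m IH w lw.
have [rw|/deletion[w' [sw lw' E]]] := pselect (reduced w); first by exists w.
have [|u [su ru Eu]] := IH (size w') _ w' (leqnn _).
  exact: leq_trans lw' lw.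
by exists u; split=> //; [exact: subseq_trans su sw | rewrite Eu].
Qed.

Lemma cox_length_reduced w : reduced w -> cox_length H L (word w) = size w.
Proof.
move=> rw; rewrite /cox_length.
have [u [E ru <-]] := @xgetPex _ 0%N [set k | exists u,
    [/\ word u = word w, reduced u & size u = k]]
  (ex_intro _ (size w) (ex_intro _ w (And3 erefl rw erefl))).
by apply/eqP; rewrite eqn_leq ru //= rw.
Qed.

Lemma cox_length_word w : (cox_length H L (word w) <= size w)%N.
Proof.
have [u [su ru <-]] := reduced_subword w.
by rewrite cox_length_reduced //; exact: size_subseq.
Qed.

(** The pairing of the first letter with the image point is nonnegative in the closed chamber and
    nonpositive by reducedness. So that letter acts trivially and can be removed. *)
Lemma reduced_fixes w x : reduced w -> closed_chamber x ->
  closed_chamber (word w x) ->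
  word w x = x /\ forall j, j \in w -> pairing j x = 0.
Proof.
move=> + Cx; elim: w => [|i w IH] rw Cwx; first by rewrite id_lfunE.
have [c Cc] := chamber_ex.
have ix : pairing i (word (i :: w) x) = 0.
  apply/eqP; rewrite eq_le (proj1 (closed_chamberE _) Cwx) andbT.
  have := word_pairing_same_side i (i :: w) Cc Cx.
  by rewrite nmulr_rge0 //; exact: reduced_pairing_lt0.
have wE : word w x = word (i :: w) x.
  by rewrite -[RHS](srefl_fix ix) word_consE sreflK.
have [|wx jx] := IH (word_tail_reduced rw); first by rewrite wE.
rewrite -wE; split=> // j; rewrite inE => /orP[/eqP ->|/jx //].
by rewrite -{1}wx wE.
Qed.

(** Write [x] as [word u l] with [l] in the closed chamber. A coroot negative at [x] is negative on
    the whole translated chamber, so by exchange its reflection shortens [u]. *)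
Lemma push_nonneg J x : tits_cone H L x ->
  exists w, (forall i, i \in w -> J i) /\
    forall j, J j -> 0 <= pairing j (word w x).
Proof.
move=> [s /coxeterP[u <-] [l Cl <-]]; have [c Cc] := chamber_ex.
elim/(@ltn_ind): {u}(size u) {-2}u (leqnn (size u)) => m IH u lu.
have [Ju|/existsNP[j /not_implyP[Jj /negP]]] :=
  pselect (forall j, J j -> 0 <= pairing j (word u l)).
  by exists [::]; split=> // j /Ju; rewrite id_lfunE.
rewrite -ltNge => jl.
have jc : pairing j (word u c) < 0.
  have := word_pairing_same_side j u Cc Cl.
  by rewrite nmulr_lge0 // => ?; rewrite lt_neqAle word_pairing_neq0.
have [u' [_ lu' E]] := exchange Cc jc.
have [|w [wJ Hw]] := IH (size u') _ u' (leqnn _); first exact: leq_trans lu' lu.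
exists (rcons w j); split=> [i|k Jk].
  by rewrite mem_rcons inE => /orP[/eqP ->|/wJ].
by rewrite word_rconsE -word_consE E; exact: Hw.
Qed.

End CoxeterGroup.

(** * Faces of an invariant cone *)

Section InvariantCone.
Context {R : realType} {h : vectType R} {n : nat}.
Local Notation dual := 'Hom(h, R^o).
Variables (H : 'I_n -> set h) (L : 'I_n -> set dual).
Hypothesis lcs : linear_coxeter_system H L.
Implicit Types (i j k : 'I_n) (x y : dual) (a b t u v w : seq 'I_n).
Implicit Types (J K : set 'I_n) (F : set dual).

Local Notation srefl := (srefl H L).
Local Notation word := (word H L).
Local Notation reduced := (reduced H L).
Local Notation closed_chamber := (closed_chamber H).
Local Notation pairing := (pairing H).

Lemma closed_chamber_orbit w x :
  closed_chamber x -> closed_chamber (word w x) -> word w x = x.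
Proof.
have [u [_ ru <-]] := reduced_subword lcs w.
by move=> Cx Cux; have [] := reduced_fixes lcs ru Cx Cux.
Qed.

Lemma closed_chamber_stabilizer w x : closed_chamber x -> word w x = x ->
  exists2 u, word u = word w & forall j, j \in u -> pairing j x = 0.
Proof.
move=> Cx wx; have [u [_ ru E]] := reduced_subword lcs w.
by exists u => //; apply: (reduced_fixes lcs ru Cx _).2; rewrite E wx.
Qed.

Lemma reduced_suffix u v : reduced (u ++ v) -> reduced v.
Proof. by elim: u => // i u IH /word_tail_reduced. Qed.

Lemma min_double_coset_le J K t a b : min_double_coset H L J K (word t) ->
  reduced t -> (forall j, j \in a -> J j) -> (forall j, j \in b -> K j) ->
  forall w, word w = word (a ++ t ++ b) -> (size t <= size w)%N.
Proof.
move=> [_ Hmin] rt aJ bK w E.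
have Pa : parabolic H L J (word a) by apply/(parabolicP lcs); exists a.
have Pb : parabolic H L K (word b) by apply/(parabolicP lcs); exists b.
have := Hmin _ _ Pa Pb.
rewrite (cox_length_reduced rt) -!word_cat -E => /leq_trans; apply.
exact: cox_length_word.
Qed.

(* Among the factorizations of an element of [W_J t W_K] as [a t b], one with
   [size a + size b] minimal is reduced: deleting letters of [t] would
   contradict the minimality of [t]. *)
Lemma min_double_coset_reduced J K t a b :
  min_double_coset H L J K (word t) -> reduced t ->
  (forall j, j \in a -> J j) -> (forall j, j \in b -> K j) ->
  exists a' b', reduced (a' ++ t ++ b') /\ word (a' ++ t ++ b') = word (a ++ t ++ b).
Proof.
move=> tmin rt.
elim/(@ltn_ind): {a b}(size a + size b)%N {-2}a {-2}b (leqnn (size a + size b)%N).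
move=> m IH a b sab aJ bK.
have [rw|/(deletion lcs)[w [+ sw Ew]]] := pselect (reduced (a ++ t ++ b)).
  by exists a, b.
move=> /subseq_cat_split[a' [w' [sa /subseq_cat_split[t' [b' [st sb w'E]]] wE]]].
have a'J j : j \in a' -> J j by move=> /(mem_subseq sa)/aJ.
have b'K j : j \in b' -> K j by move=> /(mem_subseq sb)/bK.
(* Moving [a'] and [b'] to the other side puts [word t'] in the double coset of [word t], so
   minimality prevents the loss of a letter. *)
have tt' : t' = t.
  apply/eqP; rewrite -(size_subseq_leqif st).2 eqn_leq size_subseq //=.
  apply: (min_double_coset_le tmin rt (a := rev a' ++ a) (b := b ++ rev b')).
  - by move=> j; rewrite mem_cat mem_rev => /orP[/a'J|/aJ].
  - by move=> j; rewrite mem_cat mem_rev => /orP[/bK|/b'K].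
  apply/lfunP => x; rewrite !word_catE.
  have := congr1 (fun f : 'End(dual) => f (word (rev b') x)) Ew.
  by rewrite wE w'E !word_catE => <-; rewrite word_revK // word_revVK.
have {}wE : w = a' ++ t ++ b' by rewrite wE w'E tt'.
have [|a2 [b2 [r2 E2]]] := IH (size a' + size b')%N _ a' b' (leqnn _) a'J b'K.
  move: sw; rewrite wE !size_cat addnCA [(size a + _)%N]addnCA ltn_add2l.
  by move=> /leq_trans; apply.
by exists a2, b2; split=> //; rewrite E2 -wE.
Qed.

Lemma image_word_invariant F w : (forall j, j \in w -> srefl j @` F = F) ->
  word w @` F = F.
Proof.
elim: w => [|i w IH] wF.
  apply/seteqP; split=> [_ [x Fx <-]|x Fx]; first by rewrite id_lfunE.
  by exists x; rewrite ?id_lfunE.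
rewrite -[RHS](wF i) ?mem_head // -[in RHS]IH => [|j jw]; last first.
  by apply: wF; rewrite inE jw orbT.
rewrite image_comp; apply: eq_imagel => x _; exact: word_consE.
Qed.

Lemma word_invariant F w x : (forall j, j \in w -> srefl j @` F = F) ->
  F x -> F (word w x).
Proof. by move=> wF Fx; rewrite -(image_word_invariant wF); exists x. Qed.

Lemma word_fixed w x : (forall j, j \in w -> pairing j x = 0) -> word w x = x.
Proof.
elim: w => [|j u IH] ux; first by rewrite id_lfunE.
rewrite word_consE IH => [|k ku]; last by apply: ux; rewrite inE ku orbT.
by apply: srefl_fix => //; apply: ux; rewrite mem_head.
Qed.

Variables (Y : set dual).
Hypotheses (Ytits : Y `<=` tits_cone H L) (Ycone : convex_cone Y) (Y0 : Y 0).
Hypothesis Yinv : forall s, coxeter_group H L s -> s @` Y = Y.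

Lemma word_inj w : injective (word w).
Proof. exact: can_inj (word_revK lcs w). Qed.

Lemma Fa_word w F : Fa Y F -> Fa Y (word w @` F).
Proof.
apply: Fa_image; first exact: word_inj.
by apply: Yinv; exact: coxeter_word.
Qed.

Lemma core_fixed_upsilon F x i : Fa Y F -> core F x -> pairing i x = 0 ->
  upsilon H L F i.
Proof.
move=> FF Fx ix.
have sE : srefl i = word [:: i] by rewrite /= comp_lfun1r.
have FY : F `<=` Y by case: FF => -[].
have FsF : F `<=` srefl i @` F.
  apply: (face_core_sub _ FY Ycone Fx); first by rewrite sE; exact: Fa_word.
  by exists x; [case: Fx | exact: srefl_fix].
apply/seteqP; split=> // _ [y /FsF[z Fz <-] <-].
by rewrite sreflK.
Qed.

Lemma UpsilonP F : Upsilon H Y F <->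
  Fa Y F /\ exists2 x, core F x & closed_chamber x.
Proof.
split=> -[FF [x]]; have cF : convex_cone F by case: FF => -[].
  by rewrite ri_coneE // => -[]; split=> //; exists x.
by split=> //; exists x; rewrite ri_coneE.
Qed.

(** Were [i] negative at [x], a positive combination of [x] and the core point [y] would be a core
    point on the hyperplane of [i]. *)
Lemma pairing_ge0 F i x : Upsilon H Y F -> ~ upsilon H L F i -> F x ->
  0 <= pairing i x.
Proof.
move=> /UpsilonP[FF [y Fy Cy]] ni Fx; rewrite leNgt; apply/negP => ix.
have cF : convex_cone F by case: FF => -[].
have iy : 0 < pairing i y.
  rewrite lt_neqAle (closed_chamberE lcs y).1 // andbT; apply/eqP => iy.
  by apply: ni; apply: core_fixed_upsilon FF Fy _.
apply: ni; apply: (core_fixed_upsilon (x := - pairing i x *: y + pairing i y *: x) FF).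
  by apply: coreD => //; [apply: coreZ => //; rewrite oppr_gt0 | exact: cF.2].
by rewrite pairingD !pairingZ; ring.
Qed.

(** In this form [upsilon_up] visibly grows with the face. If [srefl i] moves a point, that point or
    its reflection has negative pairing. *)
Lemma upsilon_upE F i : Upsilon H Y F ->
  upsilon_up H L F i <-> exists2 x, F x & pairing i x < 0.
Proof.
move=> UF; split=> [[iF /existsNP[x /not_implyP[Fx sx]]]|[x Fx ix]].
  have [ix|ix|ix] := ltgtP (pairing i x) 0; first by exists x.
    exists (srefl i x); last by rewrite pairing_srefl // oppr_lt0.
    by rewrite -iF; exists x.
  by case: sx; exact: srefl_fix.
split=> [|/(_ x Fx)/(srefl_fixE lcs)]; last by move=> ix0; rewrite ix0 ltxx in ix.
by apply: contrapT => /(pairing_ge0 UF)/(_ Fx); rewrite leNgt ix.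
Qed.

(** Reflections in [upsilon H L F] keep the point in [F], where all other coroots are
    nonnegative. *)
Lemma Upsilon_push F x : Upsilon H Y F -> F x -> exists w,
  [/\ forall i, i \in w -> upsilon H L F i, F (word w x) &
      closed_chamber (word w x)].
Proof.
move=> UF Fx; have FY : F `<=` Y by case: UF => -[[]].
have [w [wF Hw]] := push_nonneg lcs (upsilon H L F) (Ytits (FY _ Fx)).
have Fwx : F (word w x) by exact: word_invariant.
exists w; split=> //; apply/(closed_chamberE lcs) => i.
have [/Hw//|ni] := pselect (upsilon H L F i).
exact: pairing_ge0 UF ni Fwx.
Qed.

(* A point with a minimal number of vanishing pairings: if [srefl i] moved some
   [y] in [F] although [pairing i x = 0], pushing [y] into the cone of the
   coroots vanishing at [x] would give a better point near [x]. *)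
Lemma Upsilon_generic F : Upsilon H Y F -> exists x,
  [/\ core F x, closed_chamber x &
      forall i, pairing i x = 0 -> upsilon_lo H L F i].
Proof.
move=> /UpsilonP[FF [x]].
have [[cF FY _] _] := FF.
elim/(@ltn_ind): {x}#|[pred i | pairing i x == 0]| {-2}x
  (leqnn #|[pred i | pairing i x == 0]|) => m IH x xm Fx Cx.
have [?|/existsNP[i /not_implyP[ix]]] :=
    pselect (forall i, pairing i x = 0 -> upsilon_lo H L F i); first by exists x.
move=> /existsNP[y /not_implyP[Fy siy]].
have [w [wx Hw]] := push_nonneg lcs [set j | pairing j x = 0] (Ytits (FY _ Fy)).
have Fwy : F (word w y).
  by apply: word_invariant Fy => j /wx; exact: core_fixed_upsilon FF Fx.
have xC := (closed_chamberE lcs x).1 Cx.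
have xC0 k : pairing k x <= 0 -> pairing k x = 0.
  by move=> k0; apply/eqP; rewrite eq_le k0 xC.
have [t t0 [Ct Ht]] : exists2 t : R, 0 < t &
    closed_chamber (x + t *: word w y) /\
    forall k, 0 < pairing k x -> 0 < pairing k x + t * pairing k (word w y).
  apply: near_right_ex; near=> t; split; near: t.
    apply: (closed_chamber_translate lcs) => k.
    have [|/xC0 k0] := ltP 0 (pairing k x); first by left.
    by right; split; [exact: xC | exact: Hw].
  apply: filter_forall => k; have [k0|k0] := ltP 0 (pairing k x).
    by apply: filterS (near_right_addM_gt0 (pairing k (word w y)) k0).
  by near=> t.
have [/existsP[j /andP[/eqP jx jw]]|/existsPn nj] :=
    boolP [exists j, (pairing j x == 0) && (0 < pairing j (word w y))].
  apply: (IH _ _ (x + t *: word w y) (leqnn _)) => //; last first.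
    by apply: coreD => //; exact: cF.2.
  apply: leq_trans xm; apply: proper_card; apply/properP; split.
    apply/fintype.subsetP => k; rewrite !inE pairingD pairingZ => /eqP k0.
    by have [/Ht|/xC0/eqP//] := ltP 0 (pairing k x); rewrite k0 ltxx.
  exists j; rewrite !inE ?jx // pairingD pairingZ jx add0r.
  by rewrite gt_eqF // mulr_gt0.
(* In this case no zero pairing improves, so all coroots vanishing at [x] vanish at [word w y]. The
   letters of [w] then fix that point, which is therefore [y]. *)
have w0 j : pairing j x = 0 -> pairing j (word w y) = 0.
  move=> jx; have := nj j; rewrite jx eqxx /= -leNgt => jw.
  by apply/eqP; rewrite eq_le jw; exact: Hw.
case: siy; apply: srefl_fix => //.
by rewrite -[y](word_revK lcs w) word_fixed ?w0 // => j; rewrite mem_rev => /wx/w0.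
Unshelve. all: end_near. Qed.

(** * Meet and join of [R1] with the translate of [R2] *)

Section DoubleCoset.
Variables (R1 R2 : set dual) (t : seq 'I_n).
Hypotheses (UR1 : Upsilon H Y R1) (UR2 : Upsilon H Y R2) (rt : reduced t).
Hypothesis tmin :
  min_double_coset H L (upsilon H L R1) (upsilon H L R2) (word t).

Lemma meet_orbit x y : R1 x -> R2 y -> x = word t y -> exists a l,
  [/\ x = word a l, R1 l, R2 l, closed_chamber l &
      forall j, j \in t -> pairing j l = 0].
Proof.
move=> R1x R2y xy.
have [u [uR1 R1u Cu]] := Upsilon_push UR1 R1x.
have [v [vR2 R2v Cv]] := Upsilon_push UR2 R2y.
(* The product of [u], [t] and the inverse of [v] maps the closed chamber point [word v y] to
   [word u x]; its reduced form still contains [t]. *)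
have [|a [b [rab E]]] := min_double_coset_reduced (b := rev v) tmin rt uR1.
  by move=> j; rewrite mem_rev; exact: vR2.
have Eab : word (a ++ t ++ b) (word v y) = word u x.
  by rewrite E !word_catE word_revK // xy.
have [|luv fixl] := reduced_fixes lcs rab Cv; first by rewrite Eab.
have {}luv : word u x = word v y by rewrite -Eab luv.
exists (rev u), (word u x); split; rewrite ?word_revK //; rewrite luv // => j jt.
by apply: fixl; rewrite !mem_cat jt orbT.
Qed.

Let M := R1 `&` word t @` R2.

(** Move a core point of [M] to a closed chamber point [l] of [M]. The moved copy of [M] is a face
    with core point [l], so it lies in [M], and [face_image_sub_eq] makes them equal. *)
Lemma meet_Upsilon : Upsilon H Y M.
Proof.
have FM : Fa Y M by apply: FaI => //; [case: UR1 | apply: Fa_word; case: UR2].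
have [[cM MY _] M0] := FM.
have [x Mx] := core_cone_ex cM M0.
have [[R1x [y R2y yx]] _] := Mx.
have [a [l [xl R1l R2l Cl tl]]] := meet_orbit R1x R2y (esym yx).
have Ml : M l by split=> //; exists l => //; exact: word_fixed.
have lE : word (rev a) x = l by rewrite xl word_revK.
have cl : core (word (rev a) @` M) l by rewrite -lE; exact: core_image.
have Fg : Fa Y (word (rev a) @` M) by exact: Fa_word.
have gM : word (rev a) @` M `<=` M.
  by apply: (face_core_sub FM _ Ycone cl) => //; case: Fg => -[].
have Mg := face_image_sub_eq (@word_inj (rev a)) Ycone cM MY Fg gM.
apply/UpsilonP; split=> //; exists l => //.
by have /seteqP <- : word (rev a) @` M `<=` M /\ M `<=` word (rev a) @` M.
Qed.

(** For a generic core point [x], the point [l] of [meet_orbit] is [x] itself, as both lie in the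
    closed chamber and in one orbit. *)
Lemma meet_sub_fixed : M `<=` R2 /\ forall j, j \in t -> upsilon_lo H L M j.
Proof.
have [x [Mx Cx xlo]] := Upsilon_generic meet_Upsilon.
have [[R1x [y R2y yx]] _] := Mx.
have [a [l [xl R1l R2l Cl tl]]] := meet_orbit R1x R2y (esym yx).
have lx : l = x.
  by rewrite -[l](word_revK lcs a) -xl closed_chamber_orbit // xl word_revK.
split; last by move=> j jt; apply: xlo; rewrite -lx; exact: tl.
have MY : M `<=` Y by have [[[]]] := meet_Upsilon.
apply: (face_core_sub _ MY Ycone Mx); first by case: UR2.
by rewrite -lx.
Qed.

(* If [word v y = srefl i (word v y)], then [v^-1 srefl i v] lies in the
   stabilizer of [y], hence in [W_(upsilon R2)], and multiplying [t] by it on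
   the right deletes the letter [i]. *)
Lemma suffix_pairing_lt0 u i v y : t = u ++ i :: v -> core R2 y ->
  closed_chamber y -> pairing i (word (i :: v) y) < 0.
Proof.
move=> tE R2y Cy; have [c Cc] := chamber_ex lcs.
have rv : reduced (i :: v) by apply: (@reduced_suffix u); rewrite -tE.
have le0 : pairing i (word (i :: v) y) <= 0.
  have := word_pairing_same_side lcs i (i :: v) Cc Cy.
  by rewrite nmulr_rge0 //; exact: (reduced_pairing_lt0 lcs).
rewrite lt_neqAle le0 andbT; apply/eqP => y0.
have fixy : word (rev v ++ i :: v) y = y.
  rewrite word_catE -[X in word (rev v) X](srefl_fix lcs y0) word_consE sreflK //.
  exact: word_revK.
have [b bE by0] := closed_chamber_stabilizer Cy fixy.
have FR2 : Fa Y R2 by case: UR2.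
have bR2 j : j \in b -> upsilon H L R2 j.
  by move=> /by0; exact: core_fixed_upsilon FR2 R2y.
have : (size t <= size (u ++ v))%N.
  apply: (min_double_coset_le tmin rt (a := [::]) (b := b)) => //.
  apply/lfunP => x; rewrite cat0s tE !word_catE bE word_catE !word_consE.
  by rewrite word_revVK // sreflK.
by rewrite tE !size_cat /= addnS ltnn.
Qed.

(** If [word t] carried the chamber to the negative side of [i], exchange would give a shorter
    element of the double coset. *)
Lemma min_coset_pairing_ge0 i x : upsilon H L R1 i -> closed_chamber x ->
  0 <= pairing i (word t x).
Proof.
move=> R1i Cx; have [c Cc] := chamber_ex lcs.
have [ct|ct|/eqP] := ltgtP (pairing i (word t c)) 0.
- have [w [_ lw E]] := exchange lcs Cc ct.
  have : (size t <= size w)%N.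
    apply: (min_double_coset_le tmin rt (a := [:: i]) (b := [::])) => //.
      by move=> j; rewrite inE => /eqP ->.
    by rewrite cats0 -E.
  by rewrite leqNgt lw.
- by have := word_pairing_same_side lcs i t Cc Cx; rewrite pmulr_rge0.
- by rewrite (negPf (word_pairing_neq0 lcs _ _ Cc)).
Qed.

Let E := face_join Y R1 (word t @` R2).

Lemma join_least_face : [/\ Fa Y E, R1 `<=` E, word t @` R2 `<=` E &
  forall F, Fa Y F -> R1 `<=` F -> word t @` R2 `<=` F -> E `<=` F].
Proof.
apply: face_joinP => //; first by have [[[]]] := UR1.
have [FR2 _] := UR2.
by have [[]] := Fa_word t FR2.
Qed.

Lemma join_Upsilon : Upsilon H Y E.
Proof.
have [FE R1E R2E least] := join_least_face.
have /UpsilonP[FR1 [x R1x Cx]] := UR1; have /UpsilonP[FR2 [y R2y Cy]] := UR2.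
have FtR2 := Fa_word t FR2.
have [cE _ _] := FE.1.
have xC := (closed_chamberE lcs x).1 Cx.
(* A coroot vanishing at the core point [x] belongs to [upsilon H L R1], hence is nonnegative at
   [word t y]. *)
have [s s0 Cs] : exists2 s : R, 0 < s & closed_chamber (x + s *: word t y).
  apply: near_right_ex; apply: (closed_chamber_translate lcs) => k.
  have [|k0] := ltP 0 (pairing k x); first by left.
  have {}k0 : pairing k x = 0 by apply/eqP; rewrite eq_le k0 xC.
  right; split; first exact: xC.
  by apply: min_coset_pairing_ge0 => //; exact: core_fixed_upsilon FR1 R1x k0.
apply/UpsilonP; split=> //; exists (x + s *: word t y) => //.
have R1Y : R1 `<=` Y by case: FR1 => -[].
have tR2Y : word t @` R2 `<=` Y by case: FtR2 => -[].
have cty : core (word t @` R2) (word t y) := core_image (word t) R2y.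
have Yx : Y x by apply/R1Y; case: R1x.
have Yy : Y (s *: word t y) by apply: Ycone.2 => //; apply: tR2Y; case: cty.
(* A face containing the sum contains both summands, which are core points of [R1] and of the
   translate of [R2]. *)
apply: (core_least_face Ycone Y0 FE).
  apply: cE.1; first by apply: R1E; case: R1x.
  by apply: cE.2 => //; apply: R2E; case: cty.
move=> G FG Gxy.
have Gx : G x := face_summand FG Yx Yy Gxy.
have Gy : G (s *: word t y) by apply: (face_summand FG Yy Yx); rewrite addrC.
apply: least => //; first exact: face_core_sub FG R1Y Ycone R1x Gx.
apply: (face_core_sub FG tR2Y Ycone _ Gy); apply: coreZ => //.
by case: FtR2 => -[].
Qed.

Lemma join_letters j : j \in t -> upsilon_up H L E j.
Proof.
have [FE R1E R2E _] := join_least_face; have UE := join_Upsilon.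
have /UpsilonP[FR2 [y R2y Cy]] := UR2.
(* Letters are stripped from the left: each is negative at the current point of [E], so its
   reflection preserves [E] and leads to the next suffix. *)
suff Hsplit u v : t = u ++ v ->
    E (word v y) /\ forall i, i \in u -> upsilon_up H L E i.
  by have [] := Hsplit t [::] (esym (cats0 t)) => _; apply.
elim/last_ind: u v => [v /= <-|u i IH v].
  by split=> //; apply: R2E; exists y => //; case: R2y.
rewrite cat_rcons => tE; have [Ev uE] := IH _ tE.
have iE : upsilon_up H L E i.
  by apply/(upsilon_upE _ UE); exists (word (i :: v) y) => //;
    exact: suffix_pairing_lt0 tE R2y Cy.
split=> [|j']; last by rewrite mem_rcons inE => /orP[/eqP ->|/uE].
have [sE _] := iE; rewrite -sE; exists (word (i :: v) y) => //.
by rewrite word_consE sreflK.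
Qed.

(** The letters of [t] preserve [E], so the translation by [t] can be undone inside it. *)
Lemma join_sub : R2 `<=` E.
Proof.
move=> y R2y; have [_ _ R2E _] := join_least_face.
rewrite -(word_revK lcs t y); apply: (@word_invariant E) => [j|].
  by rewrite mem_rev => /join_letters[].
by apply: R2E; exists y.
Qed.

End DoubleCoset.

End InvariantCone.

(** * Extremality of the meet and the join *)

Theorem theorem4p18 (R : realType) (h : vectType R) (n : nat)
  (H : 'I_n -> set h) (L : 'I_n -> set 'Hom(h, R^o))
  (Y R1 R2 : set 'Hom(h, R^o)) (tau : 'End('Hom(h, R^o))) :
  linear_coxeter_system H L ->
  Y `<=` tits_cone H L ->
  convex_cone Y ->
  Y 0 ->
  (forall s, coxeter_group H L s -> s @` Y = Y) ->
  Upsilon H Y R1 ->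
  Upsilon H Y R2 ->
  min_double_coset H L (upsilon H L R1) (upsilon H L R2) tau ->
  (is_biggest
     [set F | [/\ Upsilon H Y F, F `<=` R1, F `<=` R2 &
                  red H L tau `<=` upsilon_lo H L F]]
     (R1 `&` tau @` R2) /\
   Upsilon H Y (R1 `&` tau @` R2) /\
   upsilon_lo H L R1 `|` upsilon_lo H L R2 `|` red H L tau
     `<=` upsilon_lo H L (R1 `&` tau @` R2)) /\
  (is_smallest
     [set F | [/\ Upsilon H Y F, R1 `<=` F, R2 `<=` F &
                  red H L tau `<=` upsilon_up H L F]]
     (face_join Y R1 (tau @` R2)) /\
   Upsilon H Y (face_join Y R1 (tau @` R2)) /\
   upsilon_up H L R1 `|` upsilon_up H L R2 `|` red H L tau
     `<=` upsilon_up H L (face_join Y R1 (tau @` R2))).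
Proof.
move=> lcs Ytits Ycone Y0 Yinv UR1 UR2 tmin.
have [/(coxeterP lcs)[w wtau] _] := tmin.
have [t [_ rt tw]] := reduced_subword lcs w.
move: tmin; rewrite -{}wtau -{}tw {tau w} => tmin.
have t_red j : j \in t -> red H L (word H L t) j by move=> jt; exists t.
split.
- have UM := meet_Upsilon lcs Ytits Ycone Y0 Yinv UR1 UR2 rt tmin.
  have [MR2 _] := meet_sub_fixed lcs Ytits Ycone Y0 Yinv UR1 UR2 rt tmin.
  have redM : red H L (word H L t) `<=` upsilon_lo H L (R1 `&` word H L t @` R2).
    (* [red] ranges over all reduced words, so the double coset lemma is applied to the word [u]
       that contains [j]. *)
    move=> j [u [ut ru ju]]; move: tmin; rewrite -ut => umin.
    have [_] := meet_sub_fixed lcs Ytits Ycone Y0 Yinv UR1 UR2 ru umin.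
    exact.
  split; [split|split=> //].
  + by split=> // x [].
  + move=> F [UF FR1 FR2 redF] x Fx; split; first exact: FR1.
    (* The letters of [t] fix [F] pointwise, so [x] is its own preimage. *)
    exists x; first exact: FR2.
    apply: word_fixed => // j /t_red/redF/(_ x Fx); exact: (srefl_fixE lcs j x).1.
  + move=> j [[jR1|jR2]|/redM//] x; first by move=> [/jR1].
    by move=> /MR2/jR2.
- have UE := join_Upsilon lcs Ycone Y0 Yinv UR1 UR2 rt tmin.
  have [FE R1E R2E least] := join_least_face lcs Ycone Y0 Yinv t UR1 UR2.
  have R2E' := join_sub lcs Ycone Y0 Yinv UR1 UR2 rt tmin.
  have redE : red H L (word H L t) `<=`
      upsilon_up H L (face_join Y R1 (word H L t @` R2)).
    move=> j [u [ut ru ju]]; move: tmin; rewrite -ut => umin.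
    exact: (join_letters lcs Ycone Y0 Yinv UR1 UR2 ru umin).
  split; [split|split=> //].
  + by split.
  + move=> F [UF R1F R2F redF]; apply: least => //; first by case: UF.
    move=> _ [x /R2F Fx <-]; apply: word_invariant Fx => j /t_red/redF.
    by case.
  + move=> j [[jR1|jR2]|/redE//].
      move: jR1 => /(upsilon_upE lcs Ycone Yinv _ UR1)[x /R1E Ex xj].
      by apply/(upsilon_upE lcs Ycone Yinv _ UE); exists x.
    move: jR2 => /(upsilon_upE lcs Ycone Yinv _ UR2)[x /R2E' Ex xj].
    by apply/(upsilon_upE lcs Ycone Yinv _ UE); exists x.
Qed.
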